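(* Let $n>1$ be a squarefree integer having exactly $k$ distinct prime divisors. Then: if $n$ is a prime, $Q(n)=1$; if $k$ is even, $Q(n)=0$; if $k\geq 3$ is odd, $Q(n)$ is even.
   Context: For a positive integer $n$, $Q(n):=\sum_{d\mid n,\ d\le\sqrt n}\mu(d)$, where the sum is over positive divisors $d$ of $n$ with $d\le\sqrt n$ and $\mu$ denotes the M\''obius function. *)

(* Defs.v *)
From mathcomp Require Import all_boot all_order all_algebra.

Set Implicit Arguments.
Unset Strict Implicit.
Unset Printing Implicit Defensive.

Import Order.TTheory GRing.Theory Num.Theory.

(* The guard is needed because primes 0 = [::]. *)
Definition squarefree (n : nat) : bool :=
  (0 < n) && all (fun p => ~~ (p ^ 2 %| n)) (primes n).

Lemma squarefreeP (n : nat) :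
  reflect (forall d : nat, d ^ 2 %| n -> d = 1) (squarefree n).
Proof.
apply: (iffP andP) => [[n_gt0 /allP sqf_n] d d2n | sqf_n].
  have [d_gt1 | d_lt1 | //] := ltngtP 1 d; last first.
    case: d d_lt1 d2n => // _; rewrite exp0n // dvd0n => /eqP n0.
    by rewrite n0 in n_gt0.
  have pr_p := pdiv_prime d_gt1.
  have p2n : pdiv d ^ 2 %| n by rewrite (dvdn_trans _ d2n) // dvdn_exp2r ?pdiv_dvd.
  have pn : pdiv d \in primes n.
    by rewrite mem_primes pr_p n_gt0 (dvdn_trans _ p2n) // dvdn_exp.
  by have := sqf_n _ pn; rewrite p2n.
split.
  by rewrite lt0n; apply/eqP => n0; have := sqf_n 0; rewrite n0 dvdn0 => /(_ isT).
apply/allP => p; rewrite mem_primes => /and3P[pr_p _ _].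
by apply/negP => /sqf_n p1; rewrite p1 in pr_p.
Qed.

Definition mobius (n : nat) : int :=
  if squarefree n then ((-1) ^+ size (primes n))%R else 0%R.

(* The condition d <= sqrt n is written d ^ 2 <= n; see leq_sqrt. *)
Definition Q (n : nat) : int :=
  (\sum_(d <- divisors n | (d ^ 2 <= n)%N) mobius d)%R.

Lemma leq_sqrt (R : rcfType) (d n : nat) :
  (d ^ 2 <= n)%N = (d%:R <= Num.sqrt (n%:R : R))%R.
Proof.
rewrite -[in RHS](ger0_norm (ler0n R d)) -sqrtr_sqr ler_sqrt ?ler0n //.
by rewrite -natrX ler_nat.
Qed.

(* Main.v *)
Require Import Defs.
From mathcomp Require Import all_boot all_order all_algebra.

Import GRing.Theory.

(** The divisors of a squarefree [n > 1] can be paired in two ways.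

    - Complementation [d |-> n %/ d] exchanges the divisors with [d ^ 2 <= n]
      and those with [n < d ^ 2], because [n], being squarefree and not [1],
      is not a square ([sum_divisors_pair]).
    - For a prime [p] dividing [n], the divisors prime to [p] are matched with
      their products by [p] ([sum_divisors_primeM]).

    Both are stated as identities for sums of an arbitrary function over the
    divisors of [n], so that they apply to the Moebius function [mu] as well as
    to the constant [1].  The second identity applied to [mu] gives the
    vanishing of the sum of [mu] over all divisors; the first rewrites that sum
    as [(1 + (-1) ^+ k) * Q n], since [mu (n %/ d) = (-1) ^+ k * mu d].  Hence
    [Q n = 0] when [k] is even.

    When [k] is odd this says nothing, but every [mu d] is [1] or [-1], so
    [Q n] has the parity of the number of divisors with [d ^ 2 <= n].  That
    number is half the number of all divisors, and the second identity, used
    with two different primes, shows that the latter is a multiple of 4 as soon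
    as [2 <= k].  When [n] is prime, [1] is the only divisor counted by
    [Q n]. *)

Lemma squarefree_dvd (d n : nat) : d %| n -> squarefree n -> squarefree d.
Proof.
move=> dn /squarefreeP sqf; apply/squarefreeP => e ed.
exact/sqf/(dvdn_trans ed dn).
Qed.

Lemma squarefreeM_coprime (a b : nat) : squarefree (a * b) -> coprime a b.
Proof.
move=> /squarefreeP sqf; apply/eqP/sqf.
by rewrite -mulnn dvdn_mul ?dvdn_gcdl ?dvdn_gcdr.
Qed.

Lemma size_primesM_coprime (a b : nat) : 0 < a -> 0 < b -> coprime a b ->
  size (primes (a * b)) = size (primes a) + size (primes b).
Proof.
move=> a0 b0 cab; rewrite -size_cat; apply/perm_size/uniq_perm.
- exact: primes_uniq.
- by rewrite cat_uniq !primes_uniq andbT -coprime_has_primes.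
- by move=> p; rewrite mem_cat primesM.
Qed.

Lemma mobiusM (a b : nat) : squarefree (a * b) ->
  mobius (a * b) = (mobius a * mobius b)%R.
Proof.
move=> sqf; have /andP[ab0 _] := sqf; move: (ab0); rewrite muln_gt0.
case/andP=> a0 b0.
rewrite /mobius sqf (squarefree_dvd _ _ (dvdn_mulr b (dvdnn a)) sqf).
rewrite (squarefree_dvd _ _ (dvdn_mull a (dvdnn b)) sqf) -exprD.
by rewrite size_primesM_coprime // squarefreeM_coprime.
Qed.

Lemma mobius1 : mobius 1 = 1%R.
Proof. by []. Qed.

Lemma mobius_prime (p : nat) : prime p -> squarefree p -> mobius p = (-1)%R.
Proof. by move=> pr_p sqf; rewrite /mobius sqf primes_prime. Qed.

Lemma mobius_sqr (d : nat) : squarefree d -> (mobius d * mobius d = 1)%R.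
Proof. by move=> sqf; rewrite /mobius sqf -expr2 sqrr_sign. Qed.

Lemma mobius_compl (n d : nat) : squarefree n -> d %| n ->
  mobius (n %/ d) = ((-1) ^+ size (primes n) * mobius d)%R.
Proof.
move=> sqf dn; have e : n = (n %/ d) * d by rewrite divnK.
have -> : ((-1) ^+ size (primes n) = mobius n)%R by rewrite /mobius sqf.
rewrite {2}e mobiusM -?e // -mulrA mobius_sqr ?mulr1 //.
exact: squarefree_dvd sqf.
Qed.

Lemma mobius_odd (d : nat) : squarefree d -> (2 %| (mobius d - 1)%R)%Z.
Proof. by move=> sqf; rewrite /mobius sqf -signr_odd; case: (odd _). Qed.

(** Coprimality of [p] and [m] makes the two families of divisors, [d] and
    [p * d] for [d] dividing [m], disjoint; together they exhaust the divisors
    of [p * m] because [p] is prime. *)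
Lemma sum_divisors_primeM (V : nmodType) (F : nat -> V) (p m : nat) :
    prime p -> 0 < m -> coprime p m ->
  (\sum_(d <- divisors (p * m)) F d
     = \sum_(d <- divisors m) (F d + F (p * d)%N))%R.
Proof.
move=> pr_p m0 cpm; have p0 := prime_gt0 pr_p.
have pm0 : 0 < p * m by rewrite muln_gt0 p0.
rewrite big_split /= -(big_map (muln p) predT F) -big_cat /=.
apply/perm_big/uniq_perm; first exact: divisors_uniq.
  rewrite cat_uniq divisors_uniq map_inj_uniq ?divisors_uniq ?andbT /=; last first.
    by move=> a b /eqP; rewrite eqn_pmul2l // => /eqP.
  apply/hasPn => _ /mapP[d _ ->]; rewrite -dvdn_divisors //.
  apply: contraL cpm => /(dvdn_trans (dvdn_mulr d (dvdnn p))) pm.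
  by rewrite prime_coprime // pm.
move=> d; rewrite mem_cat -!dvdn_divisors //.
have [pd | npd] := boolP (p %| d).
  have ndm : (d %| m) = false.
    by apply: contraTF cpm => /(dvdn_trans pd) pm; rewrite prime_coprime // pm.
  rewrite ndm /=; case/dvdnP: pd => e ->; rewrite mulnC dvdn_pmul2l //.
  by rewrite mem_map ?dvdn_divisors // => a b /eqP; rewrite eqn_pmul2l // => /eqP.
have /negPf-> : d \notin [seq p * i | i <- divisors m].
  by apply: contra npd => /mapP[e _ ->]; exact: dvdn_mulr.
by rewrite orbF Gauss_dvdr // coprime_sym prime_coprime.
Qed.

(** Squarefreeness rules out a divisor with [d ^ 2 = n], which would be its own
    complement and be counted twice. *)
Lemma sum_divisors_pair (V : nmodType) (F : nat -> V) (n : nat) :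
    1 < n -> squarefree n ->
  (\sum_(d <- divisors n) F d
     = \sum_(d <- divisors n | (d ^ 2 <= n)%N) (F d + F (n %/ d)%N))%R.
Proof.
move=> n1 sqf; have n0 := ltnW n1.
have compl_perm : perm_eq (divisors n) [seq n %/ d | d <- divisors n].
  have complK : {in divisors n, cancel (divn n) (divn n)}.
    by move=> d; rewrite -dvdn_divisors // => dn; rewrite divnA // mulKn.
  apply: uniq_perm; first exact: divisors_uniq.
    by rewrite (map_inj_in_uniq (can_in_inj complK)) divisors_uniq.
  move=> d; apply/idP/mapP => [dn | [e en ->]].
    exists (n %/ d); last by rewrite complK.
    by move: dn; rewrite -!dvdn_divisors // => dn; rewrite dvdn_div.
  by move: en; rewrite -!dvdn_divisors // => en; rewrite dvdn_div.
rewrite big_split /= (bigID (fun d => d ^ 2 <= n)) /=; congr (_ + _)%R.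
rewrite (perm_big _ compl_perm) /= big_map big_seq_cond [RHS]big_seq_cond.
apply: eq_bigl => d; have [dn | //] := boolP (d \in divisors n) => /=.
rewrite -dvdn_divisors // in dn.
case/dvdnP: dn => e n_eq; subst n.
have d0 : 0 < d by move: n0; rewrite muln_gt0 => /andP[].
have e0 : 0 < e by move: n0; rewrite muln_gt0 => /andP[].
(* With n = e * d, the two conditions are e < d and e <= d. *)
rewrite mulnK // -ltnNge -!mulnn ltn_pmul2l // leq_pmul2r // ltn_neqAle.
case: eqP => // de; subst e; move/squarefreeP: sqf n1 => /(_ d).
by rewrite -mulnn => /(_ (dvdnn _)) ->.
Qed.

Lemma squarefree_primeM (n : nat) : 1 < n -> squarefree n ->
  exists p m, [/\ prime p, 0 < m, coprime p m & n = p * m].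
Proof.
move=> n1 sqf; exists (pdiv n), (n %/ pdiv n).
have e : n = pdiv n * (n %/ pdiv n) by rewrite mulnC divnK ?pdiv_dvd.
split=> //; first exact: pdiv_prime.
  by rewrite divn_gt0 ?pdiv_gt0 // dvdn_leq ?pdiv_dvd // ltnW.
by apply: squarefreeM_coprime; rewrite -e.
Qed.

Lemma sum_mobius_divisors (n : nat) : 1 < n -> squarefree n ->
  (\sum_(d <- divisors n) mobius d = 0)%R.
Proof.
move=> n1 sqf; have [p [m [pr_p m0 cpm n_eq]]] := squarefree_primeM _ n1 sqf.
rewrite n_eq in sqf *; rewrite sum_divisors_primeM // big_seq big1 // => d.
rewrite -dvdn_divisors // => dm.
have sqf_pd : squarefree (p * d) := squarefree_dvd _ _ (dvdn_mul (dvdnn p) dm) sqf.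
rewrite mobiusM // (mobius_prime p) ?mulN1r ?addrN //.
by apply: squarefree_dvd sqf_pd; exact: dvdn_mulr.
Qed.

(** Splitting off two primes in turn doubles the number of divisors twice. *)
Lemma dvd4_card_divisors (n : nat) : squarefree n -> 1 < size (primes n) ->
  (4 %| (\sum_(d <- divisors n) (1 : int))%R)%Z.
Proof.
move=> sqf k2; have n1 : 1 < n by case: n k2 {sqf} => [|[]].
have [p [m [pr_p m0 cpm n_eq]]] := squarefree_primeM _ n1 sqf.
have m1 : 1 < m.
  rewrite ltn_neqAle eq_sym m0 andbT; apply: contraL k2 => /eqP m_eq.
  by rewrite n_eq m_eq muln1 primes_prime.
have sqf_m : squarefree m.
  by apply: squarefree_dvd sqf; rewrite n_eq dvdn_mull.
have [q [m' [pr_q m'0 cqm' m_eq]]] := squarefree_primeM _ m1 sqf_m.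
rewrite n_eq sum_divisors_primeM // m_eq sum_divisors_primeM //.
by apply: rpred_sum => d _.
Qed.

Lemma Q_prime (p : nat) : prime p -> Q p = 1%R.
Proof.
move=> pr_p; rewrite /Q big_mkcond -[p in divisors p]muln1.
rewrite sum_divisors_primeM ?coprimen1 // big_seq1 muln1 exp1n.
by rewrite prime_gt0 // leqNgt -{1}[p]expn1 ltn_exp2l ?prime_gt1 //= addr0 mobius1.
Qed.

(** Complementary divisors have the same value of [mobius] when the number of
    primes is even, so [Q n] is then half the sum over all divisors. *)
Lemma Q_even (n : nat) : 1 < n -> squarefree n -> ~~ odd (size (primes n)) ->
  Q n = 0%R.
Proof.
move=> n1 sqf even_k; have := sum_mobius_divisors _ n1 sqf.
rewrite sum_divisors_pair // big_seq_cond.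
under eq_bigr => d /andP[dn _].
  rewrite mobius_compl //; last by rewrite dvdn_divisors // ltnW.
  rewrite -signr_odd (negPf even_k) mul1r -mulr2n.
  over.
by rewrite -big_seq_cond sumrMnl => /eqP; rewrite Num.Theory.mulrn_eq0 => /eqP.
Qed.

(** Replacing each [mobius d] by [1] preserves parity and turns [Q n] into the
    number of small divisors, which is half of a multiple of 4. *)
Lemma dvd2_Q (n : nat) : squarefree n -> 1 < size (primes n) -> (2 %| Q n)%Z.
Proof.
move=> sqf k2; have n1 : 1 < n by case: n k2 {sqf} => [|[]].
set N : int := (\sum_(d <- divisors n | (d ^ 2 <= n)%N) 1)%R.
have N_even : (2 %| N)%Z.
  have := dvd4_card_divisors _ sqf k2.
  (* Each pair counts 2, so 4 divides 2 * N. *)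
  rewrite sum_divisors_pair // big_split /= -/N -mulr2n -(mulr_natl N).
  by rewrite (_ : (4 : int)%Z = (2 * 2)%R) // dvdz_mul2l.
rewrite -[Q n](subrK N) rpredD // /Q /N -sumrB big_seq_cond.
apply: rpred_sum => d /andP[dn _]; apply: mobius_odd.
by apply: squarefree_dvd sqf; rewrite dvdn_divisors // ltnW.
Qed.

Theorem proposition1 (n k : nat) (n_gt1 : 1 < n) (sqf_n : squarefree n)
    (size_primes_n : size (primes n) = k) :
  [/\ prime n -> Q n = 1%R,
      ~~ odd k -> Q n = 0%R
    & odd k -> 3 <= k -> (2 %| Q n)%Z].
Proof.
rewrite -size_primes_n; split; first exact: Q_prime; first exact: Q_even.
by move=> _ /ltnW; exact: dvd2_Q.
Qed.
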